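(* Let $P_A$ be a combinatorial decision problem with $P_A \in \mathsf{NP}$. If the set of scenarios $\mathsf{S}$ of $P_A^{HDRR}$ is polynomially computable, then $P_A^{HDRR} \in \mathsf{NP}$.
   Context: A combinatorial decision problem $P_A$ has instances given by a finite ground set (universe) $U$ and a tuple of relations $R=(R_1,\dots,R_r)$ with $R_1=U$, each $R_i$ a relation built from $U$ (subsets and Cartesian products of such relations), together with a set $F(R)$ of feasible solutions (tuples of relations over $U$); the instance is a YES-instance iff $F(R)\neq\emptyset$. Universe elements and tuples of relations are called combinatorial elements. A scenario is an instance of $P_A$; scenarios are obtained by activating/deactivating combinatorial elements, where deactivating an element also removes every relation element containing it. For sets $A,B$ the Hamming distance is $H(A,B)=|A\triangle B|$. The Hamming distance recoverable robust problem $P_A^{HDRR}$: the input consists of a base scenario $\sigma_0$, a set $\mathsf S$ of recovery scenarios (instances of $P_A$) and an integer $\kappa$; the question is whether there exist a feasible solution $s_0$ of $\sigma_0$ and, for every $\sigma\in\mathsf S$, a feasible solution $s_\sigma$ of $\sigma$ such that $H(s_0,s_\sigma)\le\kappa$ for all $\sigma\in\mathsf S$, the Hamming distance being taken over the universe elements occurring in the solutions. The scenario set is polynomially computable if an explicit encoding of all scenarios (as full instances) can be computed from the input in polynomial time.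
   Formalization: ''P_A in NP'' is read as: feasible solutions have polynomial size and checking that a given tuple lies in F(R) is in NP. If only deciding whether F(R) is nonempty is in NP, the claim is false, since membership in F(R) may be undecidable. *)

(* Defs.v *)
From HB Require Import structures.
From mathcomp Require Import all_boot.
From mathcomp Require Import finmap zify.
From Stdlib Require Import FunctionalExtensionality.

Set Implicit Arguments.
Unset Strict Implicit.
Unset Printing Implicit Defensive.

Local Open Scope fset_scope.
Local Open Scope nat_scope.

(** * Polynomial time and NP

    The machine model is the WHILE language over binary trees of N. D. Jones,
    "Computability and Complexity from a Programming Perspective" (MIT Press,
    1997). Every evaluation of a (sub)expression is charged the size of its
    value, so a run of cost [t] only builds trees of size at most [t]: the
    model and multitape Turing machines simulate each other with polynomial
    overhead, for functions as well as for decision problems. A tree with [n]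
    nodes stands for the word of [O(n)] bits describing it in preorder. *)

Inductive tree := Leaf | Node of tree & tree.

Fixpoint tree_eqb (t u : tree) : bool :=
  match t, u with
  | Leaf, Leaf => true
  | Node t1 t2, Node u1 u2 => tree_eqb t1 u1 && tree_eqb t2 u2
  | _, _ => false
  end.

Lemma tree_eqP : Equality.axiom tree_eqb.
Proof.
elim=> [|t1 IH1 t2 IH2] [|u1 u2] /=; try by constructor.
by apply: (iffP andP) => [[/IH1-> /IH2->]|[<- <-]] //; split; [apply/IH1|apply/IH2].
Qed.

HB.instance Definition _ := hasDecEq.Build tree tree_eqP.

Fixpoint tree_size (t : tree) : nat :=
  if t is Node t1 t2 then (tree_size t1 + tree_size t2).+1 else 1.

Definition tree_hd (t : tree) : tree := if t is Node t1 _ then t1 else Leaf.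
Definition tree_tl (t : tree) : tree := if t is Node _ t2 then t2 else Leaf.

Definition enc_bool (b : bool) : tree := if b then Node Leaf Leaf else Leaf.

Inductive expr :=
  | EVar of nat
  | ENil
  | ECons of expr & expr
  | EHd of expr
  | ETl of expr
  | EEq of expr & expr.

Inductive cmd :=
  | Assign of nat & expr
  | Seq of cmd & cmd
  | If of expr & cmd & cmd
  | While of expr & cmd.

Definition store := nat -> tree.

Definition update (s : store) (x : nat) (t : tree) : store :=
  fun y => if y == x then t else s y.

Fixpoint eval (e : expr) (s : store) : tree :=
  match e with
  | EVar x => s x
  | ENil => Leaf
  | ECons e1 e2 => Node (eval e1 s) (eval e2 s)
  | EHd e1 => tree_hd (eval e1 s)
  | ETl e1 => tree_tl (eval e1 s)
  | EEq e1 e2 => enc_bool (eval e1 s == eval e2 s)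
  end.

Fixpoint ecost (e : expr) (s : store) : nat :=
  tree_size (eval e s) +
  match e with
  | EVar _ | ENil => 0
  | ECons e1 e2 | EEq e1 e2 => ecost e1 s + ecost e2 s
  | EHd e1 | ETl e1 => ecost e1 s
  end.

(** [exec c s s' t]: started in the store [s], the command [c] terminates in
    the store [s'] at cost [t]. A test succeeds on every tree but [Leaf]. *)
Inductive exec : cmd -> store -> store -> nat -> Prop :=
  | exec_assign x e s :
      exec (Assign x e) s (update s x (eval e s)) (ecost e s).+1
  | exec_seq c1 c2 s s1 s2 t1 t2 :
      exec c1 s s1 t1 -> exec c2 s1 s2 t2 -> exec (Seq c1 c2) s s2 (t1 + t2)
  | exec_if_true e c1 c2 s s' t :
      eval e s <> Leaf -> exec c1 s s' t ->
      exec (If e c1 c2) s s' (ecost e s + t).+1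
  | exec_if_false e c1 c2 s s' t :
      eval e s = Leaf -> exec c2 s s' t ->
      exec (If e c1 c2) s s' (ecost e s + t).+1
  | exec_while_true e c s s1 s2 t1 t2 :
      eval e s <> Leaf -> exec c s s1 t1 -> exec (While e c) s1 s2 t2 ->
      exec (While e c) s s2 (ecost e s + t1 + t2).+1
  | exec_while_false e c s :
      eval e s = Leaf -> exec (While e c) s s (ecost e s).+1.

(** Input and output are in variable 0; the other variables start as [Leaf]. *)
Definition init (t : tree) : store := update (fun _ => Leaf) 0 t.

Definition poly_bound (c k n : nat) : nat := c * n ^ k + c.

Lemma tree_size_gt0 t : 0 < tree_size t.
Proof. by case: t. Qed.

Lemma poly_bound_mono (c k m n : nat) :
  0 < n -> m <= n -> poly_bound c k m <= poly_bound c k n.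
Proof.
move=> n0 le_mn; rewrite /poly_bound leq_add2r leq_mul2l.
by case: k => [|k]; rewrite ?leqnn ?leq_exp2r ?le_mn ?orbT.
Qed.

Lemma poly_bound_pow c k n : 0 < n -> poly_bound c k n <= 2 * c * n ^ k.
Proof.
move=> n0; have : 0 < n ^ k by rewrite expn_gt0 n0.
rewrite /poly_bound; nia.
Qed.

Lemma poly_bound_add c k d l : exists e m, forall n, 0 < n ->
  poly_bound c k n + poly_bound d l n <= poly_bound e m n.
Proof.
exists (2 * c + 2 * d), (k + l) => n n0.
have := poly_bound_pow c k n0; have := poly_bound_pow d l n0.
have ke : 0 < n ^ k by rewrite expn_gt0 n0.
have le : 0 < n ^ l by rewrite expn_gt0 n0.
have -> : poly_bound (2 * c + 2 * d) (k + l) n =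
    (2 * c + 2 * d) * (n ^ k * n ^ l) + (2 * c + 2 * d)
  by rewrite /poly_bound expnD.
set a := poly_bound _ _ _; set b := poly_bound _ _ _.
move: (n ^ k) (n ^ l) ke le => x y x0 y0 H1 H2.
have : 2 * d * y <= 2 * d * (x * y) by rewrite leq_mul2l leq_pmull ?orbT.
have : 2 * c * x <= 2 * c * (x * y) by rewrite leq_mul2l leq_pmulr ?orbT.
rewrite mulnDl; lia.
Qed.

Lemma poly_bound_comp c k d l : exists e m, forall n, 0 < n ->
  poly_bound c k (poly_bound d l n) <= poly_bound e m n.
Proof.
exists (c * (2 * d) ^ k + c), (l * k) => n n0.
have h := poly_bound_pow d l n0.
have : poly_bound d l n ^ k <= (2 * d) ^ k * n ^ (l * k).
  rewrite expnM -expnMn; by case: k => [//|k]; rewrite leq_exp2r.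
set q := poly_bound d l n => h'; rewrite /poly_bound mulnDl.
have : c * q ^ k <= c * ((2 * d) ^ k * n ^ (l * k)) by rewrite leq_mul2l h' orbT.
rewrite mulnA; lia.
Qed.

Definition polytime (f : tree -> tree) : Prop :=
  exists (p : cmd) (c k : nat), forall x : tree,
  exists (s : store) (t : nat),
    [/\ exec p (init x) s t, s 0 = f x & t <= poly_bound c k (tree_size x)].

(** Soundness against every certificate, completeness with a certificate of
    polynomial size. *)
Definition inNP (L : tree -> Prop) : Prop :=
  exists (f : tree -> tree) (c k : nat),
    [/\ polytime f,
        forall x w : tree, f (Node x w) <> Leaf -> L x
      & forall x : tree, L x -> exists w : tree,
          f (Node x w) <> Leaf /\ tree_size w <= poly_bound c k (tree_size x)].

(** * Combinatorial decision problems

    Universe elements are named by words, so that elements of different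
    instances can be compared. Longer tuples are iterated pairs. *)

Definition name := seq bool.

Inductive celem := Elem of name | Pair of celem & celem.

Fixpoint celem_gentree (a : celem) : GenTree.tree name :=
  match a with
  | Elem v => GenTree.Leaf v
  | Pair a1 a2 => GenTree.Node 0 [:: celem_gentree a1; celem_gentree a2]
  end.

Fixpoint gentree_celem (g : GenTree.tree name) : option celem :=
  match g with
  | GenTree.Leaf v => Some (Elem v)
  | GenTree.Node _ [:: g1; g2] =>
      if (gentree_celem g1, gentree_celem g2) is (Some a1, Some a2)
      then Some (Pair a1 a2) else None
  | _ => None
  end.

Lemma celem_gentreeK : pcancel celem_gentree gentree_celem.
Proof. by elim=> //= a1 -> a2 ->. Qed.

HB.instance Definition _ := Choice.copy celem (pcan_type celem_gentreeK).

Definition relation := {fset celem}.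

(** The relations built from [U] by Cartesian products and subsets. *)
Inductive built (U : relation) : relation -> Prop :=
  | built_univ : built U U
  | built_subset (A B : relation) : A `<=` B -> built U B -> built U A
  | built_product (A B : relation) :
      built U A -> built U B -> built U [fset Pair a b | a in A, b in B].

(** Tuples [R_1, ..., R_r] of relations; instances have [R_1 = U]. *)
Definition relsys := seq relation.

Definition universe (R : relsys) : relation := head fset0 R.

Definition wf_relsys (R : relsys) : Prop :=
  [/\ 0 < size R,
      forall a : celem, a \in universe R -> exists v : name, a = Elem v
    & forall Q : relation, Q \in R -> built (universe R) Q].

Record comb_problem := CombProblem {
  instance : relsys -> Prop;
  feasible : relsys -> relsys -> Prop;
  instance_wf : forall R : relsys, instance R -> wf_relsys R;
  feasible_built : forall R s : relsys, instance R -> feasible R s ->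
    forall Q : relation, Q \in s -> built (universe R) Q
}.

(** * Encodings

    A relation is written down by listing its elements in any order, without
    repetition. *)

Definition enc_seq (A : Type) (enc : A -> tree) (l : seq A) : tree :=
  foldr (fun a t => Node (enc a) t) Leaf l.

Fixpoint enc_elem (a : celem) : tree :=
  match a with
  | Elem v => Node Leaf (enc_seq enc_bool v)
  | Pair a1 a2 => Node (Node Leaf Leaf) (Node (enc_elem a1) (enc_elem a2))
  end.

Definition listing := seq (seq celem).

Definition relsys_of (l : listing) : relsys :=
  [seq [fset a in q] | q : seq celem <- l].

Definition enc_listing (l : listing) : tree := enc_seq (enc_seq enc_elem) l.

Definition encodes (t : tree) (R : relsys) : Prop :=
  exists l : listing, [/\ all uniq l, relsys_of l = R & t = enc_listing l].

Definition encodes_set (t : tree) (S : relsys -> Prop) : Prop :=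
  exists ls : seq listing,
    [/\ all (all uniq) ls,
        forall R : relsys, S R <-> R \in map relsys_of ls
      & t = enc_seq enc_listing ls].

(** Binary numerals, least significant bit first. *)
Definition bits_value (bs : seq bool) : nat :=
  foldr (fun (b : bool) (n : nat) => b + n.*2) 0 bs.

Definition encodes_nat (t : tree) (n : nat) : Prop :=
  exists bs : seq bool, bits_value bs = n /\ t = enc_seq enc_bool bs.

Definition yes_language (P : comb_problem) (x : tree) : Prop :=
  exists R : relsys,
    [/\ encodes x R, instance P R & exists s : relsys, feasible P R s].

Definition feasible_language (P : comb_problem) (x : tree) : Prop :=
  exists (r u : tree) (R s : relsys),
    [/\ x = Node r u, encodes r R, encodes u s, instance P R & feasible P R s].

(** Membership in NP of a combinatorial decision problem, where the objects to
    be certified are its feasible solutions: they have polynomial size, and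
    feasibility of a given solution is verified in polynomial time, possibly
    with the help of a further certificate of polynomial size. This implies
    [inNP (yes_language P)], see [comb_inNP_yes_language]; the converse fails,
    because a verifier for the mere nonemptiness of the set of feasible
    solutions says nothing about which tuples belong to it. *)
Definition comb_inNP (P : comb_problem) : Prop :=
  (exists c k : nat, forall (r : tree) (R s : relsys),
     encodes r R -> instance P R -> feasible P R s ->
     exists u : tree,
       encodes u s /\ tree_size u <= poly_bound c k (tree_size r)) /\
  inNP (feasible_language P).

Lemma comb_inNP_yes_language (P : comb_problem) :
  comb_inNP P -> inNP (yes_language P).
Proof.
case=> [[c1 [k1 bound1]] [f [c2 [k2 [[p [c3 [k3 pf]]] fs fc]]]]].
pose X := EVar 0.
pose e := ECons (ECons (EHd X) (EHd (ETl X))) (ETl (ETl X)).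
pose g t := Node (Node (tree_hd t) (tree_hd (tree_tl t))) (tree_tl (tree_tl t)).
have gsz t : tree_size (g t) <= 5 * tree_size t.
  by case: t => [|[|? ?] [|? ?]] //=; lia.
have ec t : (ecost e (init t)).+1 <= 30 * tree_size t + 30.
  by case: t => [|? [|? ?]] //=; rewrite /init /update /=; lia.
have [c4 [k4 b4]] := poly_bound_comp c3 k3 5 1.
have [c5 [k5 b5]] := poly_bound_add 30 1 c4 k4.
have [c6 [k6 b6]] := poly_bound_add 1 1 c1 k1.
have [c7 [k7 b7]] := poly_bound_comp c2 k2 c6 k6.
have [c8 [k8 b8]] := poly_bound_add c6 k6 c7 k7.
exists (f \o g), c8, k8; split.
- exists (Seq (Assign 0 e) p), c5, k5 => x.
  have [s [t [ex out le_t]]] := pf (g x).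
  have x0 := tree_size_gt0 x.
  exists s, ((ecost e (init x)).+1 + t); split=> //.
    apply: exec_seq (exec_assign _ _ _) _.
    suff -> : update (init x) 0 (eval e (init x)) = init (g x) by [].
    by apply: functional_extensionality => -[].
  have h5 := b5 _ x0; rewrite {1}/poly_bound expn1 in h5.
  have h4 := b4 _ x0.
  have hg : poly_bound c3 k3 (tree_size (g x)) <=
            poly_bound c3 k3 (poly_bound 5 1 (tree_size x)).
    by apply: poly_bound_mono; rewrite /poly_bound expn1; have := gsz x; lia.
  have := ec x; lia.
- move=> x w /fs [r [u [R [s [[-> _] er _ iR fR]]]]].
  by exists R; split=> //; exists s.
- move=> x [R [ex iR [s fR]]].
  have [u [eu le_u]] := bound1 _ _ _ ex iR fR.
  have [|w [acc le_w]] := fc (Node x u); first by exists x, u, R, s.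
  exists (Node u w); split=> //=.
  have x0 := tree_size_gt0 x.
  have h6 := b6 _ x0; rewrite {1}/poly_bound expn1 in h6.
  have h : tree_size (Node x u) <= poly_bound c6 k6 (tree_size x).
    by move: h6 le_u => /=; lia.
  have h0 := leq_trans (tree_size_gt0 _) h.
  have h' := leq_trans (poly_bound_mono c2 k2 h0 h) (b7 _ x0).
  have := b8 _ x0; rewrite /= in h; lia.
Qed.

(** * Hamming distance recoverable robustness *)

Fixpoint elem_names (a : celem) : {fset name} :=
  match a with
  | Elem v => [fset v]
  | Pair a1 a2 => elem_names a1 `|` elem_names a2
  end.

Definition solution_names (s : relsys) : {fset name} :=
  \bigcup_(Q <- s) \bigcup_(a <- Q) elem_names a.

Definition hamming (A B : {fset name}) : nat := #|` (A `\` B) `|` (B `\` A)|.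

Definition hdrr_yes (P : comb_problem) (sigma0 : relsys) (S : relsys -> Prop)
    (kappa : nat) : Prop :=
  exists s0 : relsys, feasible P sigma0 s0 /\
  forall sigma : relsys, S sigma ->
  exists s : relsys, feasible P sigma s /\
    hamming (solution_names s0) (solution_names s) <= kappa.

(** An input consists of a base scenario, a description [d] of the set of
    recovery scenarios, and the bound. [scen sigma0 d] is the set of scenarios
    described by [d] relative to [sigma0]; the description format is arbitrary
    (an explicit list, or any succinct one). Inputs with a scenario that is
    not an instance are rejected, so a malformed description may denote, e.g.,
    the singleton of the empty tuple. *)
Definition encodes_input (x : tree) (sigma0 : relsys) (d : tree) (kappa : nat)
    : Prop :=
  exists x0 xk : tree,
    [/\ x = Node x0 (Node d xk), encodes x0 sigma0 & encodes_nat xk kappa].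

Definition hdrr_language (P : comb_problem)
    (scen : relsys -> tree -> relsys -> Prop) (x : tree) : Prop :=
  exists (sigma0 : relsys) (d : tree) (kappa : nat),
    [/\ encodes_input x sigma0 d kappa, instance P sigma0,
        forall sigma : relsys, scen sigma0 d sigma -> instance P sigma
      & hdrr_yes P sigma0 (scen sigma0 d) kappa].

Definition polynomially_computable (P : comb_problem)
    (scen : relsys -> tree -> relsys -> Prop) : Prop :=
  exists f : tree -> tree, polytime f /\
  forall (x : tree) (sigma0 : relsys) (d : tree) (kappa : nat),
    encodes_input x sigma0 d kappa -> instance P sigma0 ->
    encodes_set (f x) (scen sigma0 d).

(* Main.v *)
(** A certificate for a YES-instance consists of a base solution and one
    solution for each recovery scenario, each together with a certificate of its
    feasibility. As the listing of the scenarios is computed in polynomial time,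
    the scenarios are polynomial in number and in size, and so is the whole
    certificate. The verifier computes the listing, verifies every solution
    against its scenario, and compares the Hamming distances with the bound. *)

Require Import Defs.
From mathcomp Require Import all_boot finmap zify.

Set Implicit Arguments.
Unset Strict Implicit.
Unset Printing Implicit Defensive.

Local Open Scope nat_scope.

(** * Polynomial bounds *)

Definition polysized (h : tree -> nat) : Prop :=
  exists c k, forall x, h x <= poly_bound c k (tree_size x).

Lemma polysized_le (g h : tree -> nat) :
  (forall x, h x <= g x) -> polysized g -> polysized h.
Proof.
by move=> le_hg [c [k bg]]; exists c, k => x; exact: leq_trans (le_hg x) (bg x).
Qed.

Lemma polysized_const n : polysized (fun _ => n).
Proof. by exists n, 0 => x; rewrite /poly_bound; lia. Qed.

Lemma polysized_size : polysized tree_size.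
Proof. by exists 1, 1 => x; rewrite /poly_bound expn1; lia. Qed.

Lemma polysized_add (g h : tree -> nat) :
  polysized g -> polysized h -> polysized (fun x => g x + h x).
Proof.
move=> [c [k bg]] [d [l bh]]; have [e [m bem]] := poly_bound_add c k d l.
exists e, m => x; apply: leq_trans (bem _ (tree_size_gt0 x)).
exact: leq_add.
Qed.

Lemma polysized_mul (g h : tree -> nat) :
  polysized g -> polysized h -> polysized (fun x => g x * h x).
Proof.
move=> [c [k bg]] [d [l bh]]; exists (2 * c * (2 * d)), (k + l) => x.
have bg' := leq_trans (bg x) (poly_bound_pow c k (tree_size_gt0 x)).
have bh' := leq_trans (bh x) (poly_bound_pow d l (tree_size_gt0 x)).
apply: leq_trans (leq_mul bg' bh') _.
by rewrite /poly_bound expnD mulnACA leq_addr.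
Qed.

Lemma poly_bound_le c k m n : m <= n -> poly_bound c k m <= poly_bound c k n.+1.
Proof. by move=> le_mn; apply: poly_bound_mono => //; exact: leqW. Qed.

Lemma polysized_poly_bound c k (h : tree -> nat) :
  polysized h -> polysized (fun x => poly_bound c k (h x)).
Proof.
move=> [d [l bh]]; have [a [m bam]] := poly_bound_add d l 1 0.
have [e [m' bem]] := poly_bound_comp c k a m.
exists e, m' => x; apply: leq_trans (bem _ (tree_size_gt0 x)).
have := bam _ (tree_size_gt0 x); rewrite {2}/poly_bound expn0 => le_a.
by apply: poly_bound_mono; have := bh x; lia.
Qed.

Lemma polysized_comp (h : tree -> nat) (f : tree -> tree) :
  polysized h -> polysized (tree_size \o f) -> polysized (h \o f).
Proof.
move=> [c [k bh]] /(polysized_poly_bound c k); apply: polysized_le => x.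
exact: bh.
Qed.

(** * Running a program on the variables from an offset on *)

Fixpoint shift_expr (N : nat) (e : expr) : expr :=
  match e with
  | EVar x => EVar (N + x)
  | ENil => ENil
  | ECons e1 e2 => ECons (shift_expr N e1) (shift_expr N e2)
  | EHd e1 => EHd (shift_expr N e1)
  | ETl e1 => ETl (shift_expr N e1)
  | EEq e1 e2 => EEq (shift_expr N e1) (shift_expr N e2)
  end.

Fixpoint shift_cmd (N : nat) (p : cmd) : cmd :=
  match p with
  | Assign x e => Assign (N + x) (shift_expr N e)
  | Seq p1 p2 => Seq (shift_cmd N p1) (shift_cmd N p2)
  | If e p1 p2 => If (shift_expr N e) (shift_cmd N p1) (shift_cmd N p2)
  | While e p1 => While (shift_expr N e) (shift_cmd N p1)
  end.

Fixpoint expr_width (e : expr) : nat :=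
  match e with
  | EVar x => x.+1
  | ENil => 0
  | ECons e1 e2 | EEq e1 e2 => maxn (expr_width e1) (expr_width e2)
  | EHd e1 | ETl e1 => expr_width e1
  end.

Fixpoint cmd_width (p : cmd) : nat :=
  match p with
  | Assign x e => maxn x.+1 (expr_width e)
  | Seq p1 p2 => maxn (cmd_width p1) (cmd_width p2)
  | If e p1 p2 => maxn (expr_width e) (maxn (cmd_width p1) (cmd_width p2))
  | While e p1 => maxn (expr_width e) (cmd_width p1)
  end.

Lemma eval_shift N m e (s s1 : store) :
  expr_width e <= m -> (forall i, i < m -> s1 (N + i) = s i) ->
  eval (shift_expr N e) s1 = eval e s /\ ecost (shift_expr N e) s1 = ecost e s.
Proof.
move=> + eq_s; elim: e => /= [x|//|e1 IH1 e2 IH2|e1 IH1|e1 IH1|e1 IH1 e2 IH2].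
- by move=> lt_x; rewrite eq_s.
- by rewrite geq_max => /andP[/IH1[-> ->] /IH2[-> ->]].
- by move=> /IH1[-> ->].
- by move=> /IH1[-> ->].
- by rewrite geq_max => /andP[/IH1[-> ->] /IH2[-> ->]].
Qed.

Lemma exec_shift N m p (s s' : store) t :
  exec p s s' t -> cmd_width p <= m ->
  forall s1 : store, (forall i, i < m -> s1 (N + i) = s i) ->
  exists s1' : store, [/\ exec (shift_cmd N p) s1 s1' t,
    forall i, i < m -> s1' (N + i) = s' i & forall j, j < N -> s1' j = s1 j].
Proof.
elim=> {p s s' t} /=.
- move=> x e s; rewrite geq_max => /andP[lt_x le_e] s1 eq_s.
  have [ev ec] := eval_shift le_e eq_s.
  exists (update s1 (N + x) (eval (shift_expr N e) s1)); split.
  + by rewrite -ec; exact: exec_assign.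
  + by move=> i lt_i; rewrite /update eqn_add2l ev; case: eqP => // _; exact: eq_s.
  + by move=> j lt_j; rewrite /update; case: eqP => // ?; lia.
- move=> p1 p2 s s' s'' t1 t2 _ IH1 _ IH2; rewrite geq_max => /andP[w1 w2] s1 eq_s.
  have [s2 [ex1 eq2 fr1]] := IH1 w1 _ eq_s.
  have [s3 [ex2 eq3 fr2]] := IH2 w2 _ eq2.
  exists s3; split=> //; first exact: exec_seq ex1 ex2.
  by move=> j lt_j; rewrite fr2 ?fr1.
- move=> e p1 p2 s s' t tst _ IH; rewrite !geq_max => /andP[we /andP[w1 w2]] s1 eq_s.
  have [ev ec] := eval_shift we eq_s; have [s2 [ex eq2 fr]] := IH w1 _ eq_s.
  by exists s2; split=> //; rewrite -ec; apply: exec_if_true => //; rewrite ev.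
- move=> e p1 p2 s s' t tst _ IH; rewrite !geq_max => /andP[we /andP[w1 w2]] s1 eq_s.
  have [ev ec] := eval_shift we eq_s; have [s2 [ex eq2 fr]] := IH w2 _ eq_s.
  by exists s2; split=> //; rewrite -ec; apply: exec_if_false => //; rewrite ev.
- move=> e p s s' s'' t1 t2 tst _ IH1 _ IH2 w s1 eq_s.
  have /andP[we w1] : (expr_width e <= m) && (cmd_width p <= m) by rewrite -geq_max.
  have [ev ec] := eval_shift we eq_s.
  have [s2 [ex1 eq2 fr1]] := IH1 w1 _ eq_s.
  have [s3 [ex2 eq3 fr2]] := IH2 w _ eq2.
  exists s3; split=> //; last by move=> j lt_j; rewrite fr2 ?fr1.
  by rewrite -ec; apply: exec_while_true ex1 ex2; rewrite ev.
- move=> e p s tst; rewrite geq_max => /andP[we w1] s1 eq_s.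
  have [ev ec] := eval_shift we eq_s.
  by exists s1; split=> //; rewrite -ec; apply: exec_while_false; rewrite ev.
Qed.

Lemma eval_le_ecost e s : tree_size (eval e s) <= ecost e s.
Proof. by case: e => *; exact: leq_addr. Qed.

Lemma exec_size p (s s' : store) t :
  exec p s s' t -> forall i, tree_size (s' i) <= tree_size (s i) + t.
Proof.
elim=> {p s s' t}.
- by move=> x e s i; rewrite /update; case: eqP => _; have := eval_le_ecost e s; lia.
- by move=> p1 p2 s s1 s2 t1 t2 _ IH1 _ IH2 i; have := IH1 i; have := IH2 i; lia.
- by move=> e p1 p2 s s' t _ _ IH i; have := IH i; lia.
- by move=> e p1 p2 s s' t _ _ IH i; have := IH i; lia.
- by move=> e p s s1 s2 t1 t2 _ _ IH1 _ IH2 i; have := IH1 i; have := IH2 i; lia.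
- by move=> *; exact: leq_addr.
Qed.

Fixpoint clear_above (N m : nat) : cmd :=
  if m is m'.+1 then Seq (clear_above N m') (Assign (N + m.+1) ENil)
  else Assign N.+1 ENil.

Lemma exec_clear_above N m (s : store) : exists s' : store,
  [/\ exec (clear_above N m) s s' (2 * m.+1),
      forall i, i <= m -> s' (N + i.+1) = Leaf & forall j, j <= N -> s' j = s j].
Proof.
elim: m => [|m [s1 [ex1 clr1 fr1]]] /=.
  exists (update s N.+1 Leaf); split; first exact: exec_assign.
    by case=> // _; rewrite /update addn1 eqxx.
  by move=> j le_j; rewrite /update; case: eqP => //; lia.
exists (update s1 (N + m.+2) Leaf); split.
- have -> : 2 * m.+2 = 2 * m.+1 + 2 by lia.
  exact: exec_seq ex1 (exec_assign _ _ _).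
- move=> i le_i; rewrite /update eqn_add2l; case: eqP => // ?.
  by apply: clr1; lia.
- by move=> j le_j; rewrite /update; case: eqP => [|_]; [lia|exact: fr1].
Qed.

(** The store [s] is arbitrary, unlike the initial store in [polytime], so that
    [q] can be run several times and as a part of other programs. *)
Definition runs_at (N : nat) (f : tree -> tree) (q : cmd) : Prop :=
  exists2 h : tree -> nat, polysized h &
  forall s : store, exists (s' : store) (t : nat),
    [/\ exec q s s' t, s' N = f (s N), forall j, j < N -> s' j = s j & t <= h (s N)].

Lemma polytime_runs_at f N : polytime f -> exists q, runs_at N f q.
Proof.
move=> [p [c [k pf]]]; exists (Seq (clear_above N (cmd_width p)) (shift_cmd N p)).
exists (fun x => 2 * (cmd_width p).+1 + poly_bound c k (tree_size x)).
  apply: polysized_add (polysized_const _) _.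
  exact: polysized_poly_bound polysized_size.
move=> s; have [s1 [ex1 clr fr1]] := exec_clear_above N (cmd_width p) s.
have [s2 [t [ex2 out le_t]]] := pf (s N).
have eq_s i : i < (cmd_width p).+1 -> s1 (N + i) = init (s N) i.
  case: i => [|i] lt_i; first by rewrite addn0 fr1.
  by rewrite clr //; lia.
have [s3 [ex3 eq3 fr3]] := exec_shift ex2 (leqnSn _) eq_s.
exists s3, (2 * (cmd_width p).+1 + t); split.
- exact: exec_seq ex1 ex3.
- by rewrite -{1}[N]addn0 eq3.
- by move=> j lt_j; rewrite fr3 // fr1 // ltnW.
- by rewrite leq_add2l.
Qed.

Lemma runs_at_polytime f q : runs_at 0 f q -> polytime f.
Proof.
move=> [h [c [k bh]] run]; exists q, c, k => x.
have [s [t [ex out _ le_t]]] := run (init x).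
by exists s, t; split=> //; exact: leq_trans le_t (bh _).
Qed.

Lemma polytime_size f : polytime f -> polysized (tree_size \o f).
Proof.
move=> [p [c [k pf]]].
apply: (@polysized_le (fun x => tree_size x + poly_bound c k (tree_size x))).
  move=> x; have [s [t [ex out le_t]]] := pf x.
  by have /= := exec_size ex 0; rewrite out /init /update /=; lia.
apply: polysized_add polysized_size _; exact: polysized_poly_bound polysized_size.
Qed.

Lemma polysized_polytime h f : polysized h -> polytime f -> polysized (h \o f).
Proof. by move=> hh /polytime_size; exact: polysized_comp. Qed.

(** * Closure properties of polynomial time *)

Lemma polytime_ext f g : f =1 g -> polytime f -> polytime g.
Proof.
move=> eq_fg [p [c [k pf]]]; exists p, c, k => x.
by have [s [t [ex out le_t]]] := pf x; exists s, t; rewrite -eq_fg.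
Qed.

Lemma polytime_expr e : polysized (fun x => ecost e (init x)) ->
  polytime (fun x => eval e (init x)).
Proof.
move=> [c [k be]]; exists (Assign 0 e), (c + 1), k => x.
exists (update (init x) 0 (eval e (init x))), (ecost e (init x)).+1.
by split; [exact: exec_assign| |have := be x; rewrite /poly_bound mulnDl; lia].
Qed.

Lemma polytime_id : polytime (fun x => x).
Proof.
apply: (@polytime_expr (EVar 0)); apply: polysized_le polysized_size => x.
by rewrite /= addn0.
Qed.

Lemma polytime_leaf : polytime (fun _ => Leaf).
Proof. by apply: (@polytime_expr ENil); exact: (polysized_const 1). Qed.

Lemma polytime_comp f g : polytime g -> polytime f -> polytime (fun x => g (f x)).
Proof.
move=> /(polytime_runs_at 0)[q [h bh runq]] pf.
have [p [h' bh' runp]] := polytime_runs_at 0 pf.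
apply: (@runs_at_polytime _ (Seq p q)); exists (fun x => h' x + h (f x)).
  by apply: polysized_add => //; exact: (polysized_polytime bh pf).
move=> s; have [s1 [t1 [ex1 out1 fr1 le1]]] := runp s.
have [s2 [t2 [ex2 out2 fr2 le2]]] := runq s1.
exists s2, (t1 + t2); split; [exact: exec_seq ex1 ex2| | |].
- by rewrite out2 out1.
- by [].
- by rewrite out1 in le2; exact: leq_add.
Qed.

Lemma polytime_hd f : polytime f -> polytime (fun x => tree_hd (f x)).
Proof.
apply: (@polytime_comp f tree_hd); apply: (@polytime_expr (EHd (EVar 0))).
apply: (@polysized_le (fun x => tree_size x + tree_size x)).
  by case=> [|a b] //=; lia.
exact: polysized_add polysized_size polysized_size.
Qed.

Lemma polytime_tl f : polytime f -> polytime (fun x => tree_tl (f x)).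
Proof.
apply: (@polytime_comp f tree_tl); apply: (@polytime_expr (ETl (EVar 0))).
apply: (@polysized_le (fun x => tree_size x + tree_size x)).
  by case=> [|a b] //=; lia.
exact: polysized_add polysized_size polysized_size.
Qed.

Lemma polytime_node f g :
  polytime f -> polytime g -> polytime (fun x => Node (f x) (g x)).
Proof.
move=> pf pg; have [p [hp bp runp]] := polytime_runs_at 2 pf.
have [q [hq bq runq]] := polytime_runs_at 1 pg.
apply: (@runs_at_polytime _ (Seq (Seq (Assign 1 (EVar 0)) q)
  (Seq (Seq (Assign 2 (EVar 0)) p) (Assign 0 (ECons (EVar 2) (EVar 1)))))).
exists (fun x => 2 * tree_size x + (hq x + hp x) +
    2 * (tree_size (f x) + tree_size (g x)) + 4).
  have pX h : polytime h -> polysized (fun x => tree_size (h x)).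
    exact: polytime_size.
  by repeat apply: polysized_add => //;
    try exact: polysized_const || exact: polysized_size; exact: pX.
move=> s; pose s1 := update s 1 (s 0).
have [s2 [t2 [ex2 out2 fr2 le2]]] := runq s1; pose s3 := update s2 2 (s2 0).
have [s4 [t4 [ex4 out4 fr4 le4]]] := runp s3.
have s20 : s2 0 = s 0 by rewrite fr2.
have s42 : s4 2 = f (s 0) by rewrite out4 /s3 /update /= s20.
have s41 : s4 1 = g (s 0) by rewrite fr4 // /s3 /update /= out2.
have c1 : ecost (EVar 0) s = tree_size (s 0) by rewrite /= addn0.
exists (update s4 0 (Node (s4 2) (s4 1))); eexists; split.
- exact: exec_seq (exec_seq (exec_assign 1 (EVar 0) s) ex2)
    (exec_seq (exec_seq (exec_assign 2 (EVar 0) s2) ex4) (exec_assign 0 _ s4)).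
- by rewrite /update /= s42 s41.
- by [].
- move: le2 le4; rewrite /s1 /s3 /update /= s20 s41 s42; lia.
Qed.

Definition polytest (b : tree -> bool) : Prop := polytime (fun x => enc_bool (b x)).

Lemma polytest_eq f g :
  polytime f -> polytime g -> polytest (fun x => f x == g x).
Proof.
move=> pf pg; pose e := EEq (EHd (EVar 0)) (ETl (EVar 0)).
have pe : polytime (fun x => eval e (init x)).
  apply: polytime_expr; apply: (@polysized_le (fun x => 4 * tree_size x + 3)).
    move=> x; have -> : ecost e (init x) =
        tree_size (enc_bool (tree_hd x == tree_tl x)) +
        (tree_size (tree_hd x) + (tree_size x + 0) +
         (tree_size (tree_tl x) + (tree_size x + 0))) by [].
    have : tree_size (enc_bool (tree_hd x == tree_tl x)) <= 3 by case: (_ == _).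
    by move: (tree_size (enc_bool _)); case: x => [|a b] n /=; lia.
  apply: polysized_add (polysized_const _).
  exact: polysized_mul (polysized_const _) polysized_size.
exact: (polytime_comp pe (polytime_node pf pg)).
Qed.

Lemma polytime_if b f g : polytest b -> polytime f -> polytime g ->
  polytime (fun x => if b x then f x else g x).
Proof.
move=> pb pf pg; have [p [hp bp runp]] := polytime_runs_at 0 pf.
have [q [hq bq runq]] := polytime_runs_at 0 pg.
have [r [hr br runr]] := polytime_runs_at 1 pb.
apply: (@runs_at_polytime _ (Seq (Seq (Assign 1 (EVar 0)) r) (If (EVar 1) p q))).
exists (fun x => tree_size x + hr x + (hp x + hq x) + 5).
  by repeat apply: polysized_add => //; exact: polysized_const || exact: polysized_size.
move=> s; have [s2 [t2 [ex2 out2 fr2 le2]]] := runr (update s 1 (s 0)).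
have s20 : s2 0 = s 0 by rewrite fr2.
rewrite /update /= in out2 le2; case bs: (b (s 0)) out2 => /= out2.
- have [s3 [t3 [ex3 out3 fr3 le3]]] := runp s2; exists s3; eexists; split.
  + apply: exec_seq (exec_seq (exec_assign 1 (EVar 0) s) ex2) _.
    by apply: exec_if_true ex3; rewrite /= out2.
  + by rewrite out3 s20.
  + by [].
  + by rewrite s20 in le3; rewrite /= out2 /=; lia.
- have [s3 [t3 [ex3 out3 fr3 le3]]] := runq s2; exists s3; eexists; split.
  + apply: exec_seq (exec_seq (exec_assign 1 (EVar 0) s) ex2) _.
    by apply: exec_if_false ex3; rewrite /= out2.
  + by rewrite out3 s20.
  + by [].
  + by rewrite s20 in le3; rewrite /= out2 /=; lia.
Qed.

Lemma polytest_true : polytest (fun _ => true).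
Proof. exact: polytime_node polytime_leaf polytime_leaf. Qed.

Lemma polytest_neg b : polytest b -> polytest (fun x => ~~ b x).
Proof.
move=> pb; apply: polytime_ext (polytime_if pb polytime_leaf polytest_true) => x.
by case: (b x).
Qed.

Lemma polytest_and b1 b2 :
  polytest b1 -> polytest b2 -> polytest (fun x => b1 x && b2 x).
Proof.
move=> p1 p2; apply: polytime_ext (polytime_if p1 p2 polytime_leaf) => x.
by case: (b1 x).
Qed.

Lemma polytest_or b1 b2 :
  polytest b1 -> polytest b2 -> polytest (fun x => b1 x || b2 x).
Proof.
move=> p1 p2; apply: polytime_ext (polytime_if p1 polytest_true p2) => x.
by case: (b1 x).
Qed.

Lemma polytest_leaf f : polytime f -> polytest (fun x => f x == Leaf).
Proof. by move=> pf; apply: polytest_eq pf polytime_leaf. Qed.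

(** The size of the first component bounds the number of steps that change the
    argument, whence the number of iterations in [loop]. *)
Definition loop_step (step : tree -> tree) : Prop :=
  (forall y, tree_hd y = Leaf -> step y = y) /\
  (forall y, tree_hd y <> Leaf ->
    tree_size (tree_hd (step y)) < tree_size (tree_hd y)).

Definition loop (step : tree -> tree) (x : tree) : tree :=
  iter (tree_size (tree_hd x)) step x.

Lemma iter_loop_step step n x : loop_step step ->
  tree_size (tree_hd x) <= n -> tree_hd (iter n step x) = Leaf.
Proof.
move=> [stop dec]; elim: n x => [|n IH] x; first by have := tree_size_gt0 (tree_hd x); lia.
rewrite iterSr => le_n; case: (tree_hd x =P Leaf) => [x0|/dec lt_x].
  by rewrite stop //; elim: {le_n IH} n => //= n IH; rewrite stop.
by apply: IH; lia.
Qed.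

Lemma loop_iter step n x : loop_step step -> tree_hd (iter n step x) = Leaf ->
  loop step x = iter n step x.
Proof.
move=> ls xn; have [stop _] := ls.
have stable m y : tree_hd y = Leaf -> iter m step y = y.
  by move=> y0; elim: m => //= m ->; exact: stop.
have x0 := iter_loop_step ls (leqnn (tree_size (tree_hd x))).
rewrite /loop -(stable n _ x0) -iterD addnC iterD.
exact: stable.
Qed.

Lemma polytime_loop step (g : tree -> tree) (B : tree -> nat) :
  loop_step step -> polytime step -> polytime g -> polysized B ->
  (forall x n, tree_size (iter n step (g x)) <= B x) ->
  polytime (fun x => loop step (g x)).
Proof.
move=> [stop dec] pstep pg bB leB.
have [q [h [c [k bh]] runq]] := polytime_runs_at 0 pstep.
have [p [hp bp runp]] := polytime_runs_at 0 pg.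
pose K x := poly_bound c k (B x).+1 + 2 * B x + 1.
have run n K' (s : store) : tree_size (tree_hd (s 0)) <= n ->
    (forall i, h (iter i step (s 0)) + 2 * tree_size (iter i step (s 0)) + 1 <= K') ->
    exists (s' : store) (t : nat), [/\ exec (While (EHd (EVar 0)) q) s s' t,
      s' 0 = iter n step (s 0) & t <= n.+1 * K'].
  have hdc (s1 : store) : ecost (EHd (EVar 0)) s1 <= 2 * tree_size (s1 0).
    by rewrite /=; case: (s1 0) => [|a b] //=; lia.
  elim: n s => [|n IH] s; first by have := tree_size_gt0 (tree_hd (s 0)); lia.
  case: (tree_hd (s 0) =P Leaf) => [s0|s0] le_n leK.
    exists s; eexists; split; first exact: exec_while_false.
      by elim: (n.+1) => //= m <-; rewrite stop.
    by have := leK 0; have := hdc s; rewrite [iter 0 _ _]/= => H1 H2; nia.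
  have [s1 [t1 [ex1 out1 _ le1]]] := runq s.
  have [||s2 [t2 [ex2 out2 le2]]] := IH s1.
  - by have := dec _ s0; rewrite out1; lia.
  - by move=> i; rewrite out1 -iterSr; exact: leK.
  exists s2; eexists; split; first exact: exec_while_true ex1 ex2.
    by rewrite out2 out1 -iterSr.
  by have := leK 0; have := hdc s; rewrite [iter 0 _ _]/= mulSn; lia.
apply: (@runs_at_polytime _ (Seq p (While (EHd (EVar 0)) q))).
exists (fun x => hp x + (tree_size (g x) + 1) * K x).
  apply: polysized_add => //; apply: polysized_mul.
    by apply: polysized_add (polysized_const _); exact: polytime_size.
  apply: polysized_add (polysized_const _); apply: polysized_add.
    apply: polysized_poly_bound; apply: (polysized_le _ (polysized_add bB (polysized_const 1))).
    by move=> x; lia.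
  exact: polysized_mul (polysized_const _) bB.
move=> s; have [s1 [t1 [ex1 out1 _ le1]]] := runp s.
have [|s2 [t2 [ex2 out2 le2]]] := run _ (K (s 0)) s1 (leqnn _).
  move=> i; rewrite out1 /K; have leBi := leB (s 0) i.
  have := leq_trans (bh _) (poly_bound_le c k leBi); lia.
exists s2, (t1 + t2); split=> //; first exact: exec_seq ex1 ex2.
  by rewrite out2 out1.
apply: leq_add le1 (leq_trans le2 _); rewrite out1 leq_mul2r addn1 ltnS.
by apply/orP; right; case: (g (s 0)) => [|a b] //=; lia.
Qed.

(** * Lists *)

Fixpoint spine (t : tree) : seq tree :=
  if t is Node a t' then a :: spine t' else [::].

Lemma spine_enc_seq (A : Type) (enc : A -> tree) l :
  spine (enc_seq enc l) = map enc l.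
Proof. by elim: l => //= a l ->. Qed.

Lemma enc_seq_spine (A : Type) (enc : A -> tree) t l :
  spine t = map enc l -> t = enc_seq enc l.
Proof. by elim: l t => [|a l IH] [|u t] //= [-> /IH->]. Qed.

Lemma enc_seq_inj (A : Type) (enc : A -> tree) :
  injective enc -> injective (enc_seq enc).
Proof.
move=> inj_enc l1 l2 /(congr1 spine); rewrite !spine_enc_seq.
exact: inj_map.
Qed.

Lemma size_spine t : 2 * size (spine t) < tree_size t.
Proof. by elim: t => //= a _ t IH; have := tree_size_gt0 a; lia. Qed.

Lemma tree_size_mem_spine t e : e \in spine t -> tree_size e <= tree_size t.
Proof.
by elim: t => //= a _ t IH; rewrite inE => /orP[/eqP->|/IH]; lia.
Qed.

Definition fold_step (f : tree -> tree -> tree -> tree) (y : tree) : tree :=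
  let l := tree_hd y in let c := tree_hd (tree_tl y) in
  if l == Leaf then y
  else Node (tree_tl l) (Node c (f c (tree_hd l) (tree_tl (tree_tl y)))).

Lemma fold_step_loop f : loop_step (fold_step f).
Proof.
split=> y; rewrite /fold_step; first by move=> ->; rewrite eqxx.
by case: (tree_hd y) => //= a b _; have := tree_size_gt0 a; lia.
Qed.

Lemma loop_fold f l c a :
  loop (fold_step f) (Node l (Node c a)) =
  Node Leaf (Node c (foldl (fun a e => f c e a) a (spine l))).
Proof.
have run : iter (size (spine l)) (fold_step f) (Node l (Node c a)) =
    Node Leaf (Node c (foldl (fun a e => f c e a) a (spine l))).
  by elim: l a => //= e _ l IH a; rewrite -IH -iterS iterSr.
by rewrite -run; apply: loop_iter; [exact: fold_step_loop|rewrite run].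
Qed.

Lemma iter_fold_step_size f H n l c a :
  (forall e a', tree_size e <= tree_size l ->
    tree_size (f c e a') <= tree_size a' + H) ->
  tree_size (iter n (fold_step f) (Node l (Node c a))) <=
  tree_size l + tree_size c + tree_size a + 2 + tree_size l * H.
Proof.
elim: n l a => [|n IH] l a leH; first by rewrite /=; lia.
rewrite iterSr; case: l leH => [|e l] leH.
  by apply: leq_trans (IH Leaf a _) _ => // e a' le_e; exact: leH.
apply: leq_trans (IH l (f c e a) _) _ => [e' a' le_e|].
  by apply: leH; rewrite /=; lia.
have /= := leH e a; have := tree_size_gt0 e; nia.
Qed.

Lemma polytime_fold (f : tree -> tree -> tree -> tree) (c l a : tree -> tree)
    (h : tree -> nat) :
  polytime (fun z => f (tree_hd z) (tree_hd (tree_tl z)) (tree_tl (tree_tl z))) ->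
  polysized h ->
  (forall c e a, tree_size (f c e a) <= tree_size a + h (Node c e)) ->
  polytime c -> polytime l -> polytime a ->
  polytime (fun x => foldl (fun a e => f (c x) e a) (a x) (spine (l x))).
Proof.
move=> pf [d [k bh]] leh pc pl pa.
apply: (@polytime_ext (fun x => tree_tl (tree_tl
    (loop (fold_step f) (Node (l x) (Node (c x) (a x))))))).
  by move=> x; rewrite loop_fold.
do 2 apply: polytime_tl.
pose H x := poly_bound d k (tree_size (l x) + tree_size (c x) + 1).
apply: (@polytime_loop _ _ (fun x => tree_size (l x) + tree_size (c x) +
  tree_size (a x) + 2 + tree_size (l x) * H x)).
- exact: fold_step_loop.
- rewrite /fold_step; apply: polytime_if.
  + by apply: polytest_leaf; exact: (polytime_hd polytime_id).
  + exact: polytime_id.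
  + apply: polytime_node; first by apply: polytime_tl; exact: (polytime_hd polytime_id).
    apply: polytime_node; first by apply: polytime_hd; exact: (polytime_tl polytime_id).
    apply: (polytime_comp pf (f := fun y => Node (tree_hd (tree_tl y))
      (Node (tree_hd (tree_hd y)) (tree_tl (tree_tl y))))).
    apply: polytime_node; first by apply: polytime_hd; exact: (polytime_tl polytime_id).
    apply: polytime_node; first by apply: polytime_hd; exact: (polytime_hd polytime_id).
    by apply: polytime_tl; exact: (polytime_tl polytime_id).
- by apply: polytime_node => //; exact: polytime_node.
- have sl := polytime_size pl; have sc := polytime_size pc; have sa := polytime_size pa.
  apply: polysized_add.
    by repeat apply: polysized_add => //; exact: polysized_const.
  apply: polysized_mul => //; apply: polysized_poly_bound.
  by repeat apply: polysized_add => //; exact: polysized_const.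
- move=> x n; apply: iter_fold_step_size => e a' le_e.
  apply: leq_trans (leh _ _ _) _; rewrite leq_add2l.
  apply: leq_trans (bh _) (poly_bound_mono _ _ _ _); first by lia.
  by rewrite /=; lia.
Qed.

(** * Names occurring in a solution *)

Lemma enc_bool_inj : injective enc_bool.
Proof. by case; case. Qed.

Definition enc_name : name -> tree := enc_seq enc_bool.

Lemma enc_name_inj : injective enc_name.
Proof. exact: enc_seq_inj enc_bool_inj. Qed.

Lemma enc_elem_inj : injective enc_elem.
Proof.
elim=> [v|a1 IH1 a2 IH2] [w|b1 b2] //=; first by case=> /enc_name_inj->.
by case=> /IH1-> /IH2->.
Qed.

Lemma enc_listing_inj : injective enc_listing.
Proof. by apply: enc_seq_inj; apply: enc_seq_inj; exact: enc_elem_inj. Qed.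

(** A depth-first traversal; the state consists of the stack of elements still
    to be visited and the list of names found so far. *)
Definition walk_step (y : tree) : tree :=
  let e := tree_hd (tree_hd y) in
  let st := tree_tl (tree_hd y) in
  let acc := tree_tl y in
  if tree_hd y == Leaf then y
  else if tree_hd e == Leaf then Node st (Node (tree_tl e) acc)
  else Node (Node (tree_hd (tree_tl e)) (Node (tree_tl (tree_tl e)) st)) acc.

Lemma walk_step_loop : loop_step walk_step.
Proof.
split=> y; rewrite /walk_step; first by move=> ->; rewrite eqxx.
case: (tree_hd y) => // [[|[|a b] [|c d]] st] _ /=; try lia.
by have := tree_size_gt0 a; lia.
Qed.

Lemma walk_step_size y : tree_size (walk_step y) <= tree_size y.
Proof.
rewrite /walk_step; case: y => [|[|[|[|a b] [|c d]] st] acc] //=; lia.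
Qed.

Lemma iter_walk_step_size n y : tree_size (iter n walk_step y) <= tree_size y.
Proof. by elim: n => //= n; apply: leq_trans; exact: walk_step_size. Qed.

Lemma iter_walk_elem a st acc : exists (n : nat) (acc' : tree),
  iter n walk_step (Node (Node (enc_elem a) st) acc) = Node st acc' /\
  forall t, t \in spine acc' <->
    t \in spine acc \/ exists2 v, v \in elem_names a & t = enc_name v.
Proof.
elim: a st acc => [v|a1 IH1 a2 IH2] st acc.
  exists 1, (Node (enc_name v) acc); split=> // t; rewrite /= inE; split.
    by case/orP=> [/eqP->|]; [right; exists v; rewrite ?inE|left].
  by case=> [->|[w]]; rewrite ?orbT // inE => /eqP-> ->; rewrite eqxx.
have [n1 [acc1 [run1 in1]]] := IH1 (Node (enc_elem a2) st) acc.
have [n2 [acc2 [run2 in2]]] := IH2 st acc1.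
exists (n2 + (n1 + 1)), acc2; split; first by rewrite !iterD /= run1.
move=> t; rewrite in2 in1 /=; split.
  case=> [[|[v]]|[v]]; first by left.
    by move=> v1 ->; right; exists v; rewrite // inE v1.
  by move=> v2 ->; right; exists v; rewrite // inE v2 orbT.
case=> [|[v]]; first by left; left.
by rewrite inE => /orP[] v_in ->; [left; right|right]; exists v.
Qed.

Lemma iter_walk_seq els acc : exists (n : nat) (acc' : tree),
  iter n walk_step (Node (enc_seq enc_elem els) acc) = Node Leaf acc' /\
  forall t, t \in spine acc' <-> t \in spine acc \/
    exists a v, [/\ a \in els, v \in elem_names a & t = enc_name v].
Proof.
elim: els acc => [|a els IH] acc /=.
  by exists 0, acc; split=> // t; split=> [|[|[? [? []]]]] //; left.
have [n1 [acc1 [run1 in1]]] := iter_walk_elem a (enc_seq enc_elem els) acc.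
have [n2 [acc2 [run2 in2]]] := IH acc1.
exists (n2 + n1), acc2; split; first by rewrite iterD run1.
move=> t; rewrite in2 in1; split.
  case=> [[|[v v_a ->]]|[b [v [b_els v_b ->]]]]; first by left.
    by right; exists a, v; rewrite mem_head.
  by right; exists b, v; rewrite inE b_els orbT.
case=> [|[b [v []]]]; first by left; left.
rewrite inE => /orP[/eqP->|b_els] v_b ->; first by left; right; exists v.
by right; exists b, v.
Qed.

Definition walk (q acc : tree) : tree := tree_tl (loop walk_step (Node q acc)).

Lemma walk_seq els acc t :
  t \in spine (walk (enc_seq enc_elem els) acc) <-> t \in spine acc \/
    exists a v, [/\ a \in els, v \in elem_names a & t = enc_name v].
Proof.
have [n [acc' [run in']]] := iter_walk_seq els acc.
by rewrite /walk (loop_iter (n := n)) ?run //; exact: walk_step_loop.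
Qed.

Definition names_tree (u : tree) : tree := foldl (fun acc q => walk q acc) Leaf (spine u).

Lemma mem_names_tree u s t : encodes u s ->
  t \in spine (names_tree u) <-> exists2 v, v \in solution_names s & t = enc_name v.
Proof.
case=> l [_ <- ->]; rewrite /names_tree spine_enc_seq.
have -> acc : t \in spine (foldl (fun acc q => walk q acc) acc (map (enc_seq enc_elem) l))
    <-> t \in spine acc \/ exists q a v,
      [/\ q \in l, a \in q, v \in elem_names a & t = enc_name v].
  elim: l acc => [|q l IH] acc /=.
    by split=> [|[|[? [? [? []]]]]] //; left.
  rewrite IH walk_seq; split.
    case=> [[|[a [v [a_q v_a ->]]]]|[q' [a [v [q'_l a_q v_a ->]]]]]; first by left.
      by right; exists q, a, v; rewrite mem_head.
    by right; exists q', a, v; rewrite inE q'_l orbT.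
  case=> [|[q' [a [v []]]]]; first by left; left.
  rewrite inE => /orP[/eqP->|q'_l] a_q v_a ->; first by left; right; exists a, v.
  by right; exists q', a, v.
split=> [[//|[q [a [v [q_l a_q v_a ->]]]]]|[v]].
  exists v => //; apply/bigfcupP; exists [fset b in q]%fset.
    by rewrite andbT; apply/mapP; exists q.
  by apply/bigfcupP; exists a; rewrite // andbT !inE.
case/bigfcupP=> Q; rewrite andbT => /mapP[q q_l ->] /bigfcupP[a].
rewrite andbT !inE => a_q v_a ->.
by right; exists q, a, v.
Qed.

Create HintDb polytime.
#[local] Hint Resolve polytime_id polytime_leaf polytime_hd polytime_tl polytime_node
  polytime_if polytest_eq polytest_leaf polytest_neg polytest_and polytest_or
  polytest_true : polytime.

Lemma polytime_names_tree f : polytime f -> polytime (fun x => names_tree (f x)).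
Proof.
move=> pf; apply: (@polytime_fold (fun _ q acc => walk q acc) (fun _ => Leaf) f
  (fun _ => Leaf) tree_size) => //; try exact: polytime_leaf; last first.
- move=> c q acc; rewrite /walk.
  have := iter_walk_step_size (tree_size q) (Node q acc).
  by rewrite /loop /=; case: (iter _ _ _) => [|a b] /=; lia.
- exact: polysized_size.
apply: polytime_tl; apply: (polytime_loop walk_step_loop (B :=
  fun z => tree_size (Node (tree_hd (tree_tl z)) (tree_tl (tree_tl z))))).
- by rewrite /walk_step; auto 10 with polytime.
- by auto with polytime.
- by apply: (@polytime_size (fun z => Node _ _)); auto with polytime.
- by move=> x n; exact: iter_walk_step_size.
Qed.

(** * Comparing the Hamming distance with a binary bound *)

Lemma polytest_all p f :
  polytest p -> polytime f -> polytest (fun x => all p (spine (f x))).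
Proof.
move=> pp pf; pose g (_ e a : tree) := enc_bool (p e && (a != Leaf)).
apply: (@polytime_ext (fun x => foldl (fun a e => g Leaf e a) (Node Leaf Leaf) (spine (f x)))).
  move=> x; suff h b : foldl (fun a e => g Leaf e a) (enc_bool b) (spine (f x)) =
      enc_bool (b && all p (spine (f x))) by exact: (h true).
  elim: (spine (f x)) b => [|e l IH] b /=; first by rewrite andbT.
  by rewrite IH; case: b; rewrite /= ?andbF ?andbT.
apply: (@polytime_fold _ _ _ _ (fun _ => 2)).
- rewrite /g; apply: polytest_and; last by auto with polytime.
  by apply: (polytime_comp pp); auto with polytime.
- exact: polysized_const.
- by move=> c e a; rewrite /g; have := tree_size_gt0 a; case: (_ && _) => /=; lia.
- exact: polytime_leaf.
- by [].
- by auto with polytime.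
Qed.

Lemma polytest_mem f g : polytime f -> polytime g ->
  polytest (fun x => f x \in spine (g x)).
Proof.
move=> pf pg; pose h (c e a : tree) := enc_bool ((e == c) || (a != Leaf)).
apply: (@polytime_ext (fun x => foldl (fun a e => h (f x) e a) Leaf (spine (g x)))).
  move=> x; suff hb b : foldl (fun a e => h (f x) e a) (enc_bool b) (spine (g x)) =
      enc_bool (b || (f x \in spine (g x))) by exact: (hb false).
  elim: (spine (g x)) b => [|e l IH] b /=; first by rewrite orbF.
  by rewrite IH inE eq_sym; case: b; rewrite /= ?orbT ?orbF.
apply: (@polytime_fold _ _ _ _ (fun _ => 2)) => //; try by rewrite /h; auto 10 with polytime.
- by rewrite /h; apply: polytest_or; auto 10 with polytime.
- exact: polysized_const.
- by move=> c e a; rewrite /h; have := tree_size_gt0 a; case: (_ || _) => /=; lia.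
Qed.

#[local] Hint Resolve polytime_names_tree polytest_all polytest_mem : polytime.

Definition add_diff (A B acc : tree) : tree :=
  foldl (fun acc e => if (e \in spine B) || (e \in spine acc) then acc else Node e acc)
    acc (spine A).

Lemma polytime_add_diff f g h : polytime f -> polytime g -> polytime h ->
  polytime (fun x => add_diff (f x) (g x) (h x)).
Proof.
move=> pf pg ph; apply: (@polytime_fold (fun B e acc =>
  if (e \in spine B) || (e \in spine acc) then acc else Node e acc) g f h tree_size) => //.
- by auto 10 with polytime.
- exact: polysized_size.
- by move=> c e a; case: ifP => _ /=; lia.
Qed.

Lemma mem_add_diff A B acc t : (t \in spine (add_diff A B acc)) =
  (t \in spine acc) || (t \in spine A) && (t \notin spine B).
Proof.
rewrite /add_diff; elim: (spine A) acc => [|e l IH] acc /=; first by rewrite orbF.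
rewrite IH [in RHS]inE; case: ifP; rewrite /= ?inE; have [->|_] := eqVneq t e => //=.
  by case: (e \in spine B); rewrite /= ?andbF ?andbT // => ->.
by case: (e \in spine B) => //=; rewrite orbT.
Qed.

Lemma uniq_add_diff A B acc : uniq (spine acc) -> uniq (spine (add_diff A B acc)).
Proof.
rewrite /add_diff; elim: (spine A) acc => [|e l IH] acc //= ua.
by apply: IH; case: ifP => //= /norP[_ ->].
Qed.

Definition half_step (a : tree) : tree :=
  if tree_hd a == Leaf then Node (Node Leaf Leaf) (Node Leaf (tree_tl a))
  else Node Leaf (tree_tl a).

Definition half_list (t : tree) : tree :=
  tree_tl (foldl (fun a _ => half_step a) (Node Leaf Leaf) (spine t)).

Lemma size_half_list t : size (spine (half_list t)) = uphalf (size (spine t)).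
Proof.
rewrite /half_list; suff h b a :
  size (spine (tree_tl (foldl (fun a _ => half_step a) (Node (enc_bool b) a) (spine t)))) =
  size (spine a) + (if b then (size (spine t))./2 else uphalf (size (spine t)))
  by exact: (h false).
elim: (spine t) b a => [|e l IH] [] a; rewrite [foldl _ _ _]/= ?[half_step _]/= ?addn0 //.
  by rewrite (IH false).
by rewrite (IH true) /= addnS.
Qed.

Lemma tree_size_half_list t : tree_size (half_list t) <= tree_size t.
Proof.
apply: leq_trans (size_spine t); rewrite /half_list.
suff h b a : tree_size (tree_tl (foldl (fun a _ => half_step a) (Node b a) (spine t))) <=
    tree_size a + 2 * size (spine t) by apply: leq_trans (h _ _) _.
elim: (spine t) b a => [|e l IH] b a /=; first by lia.
by rewrite {2}/half_step; case: ifP => _; apply: leq_trans (IH _ _) _; rewrite /=; lia.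
Qed.

Lemma polytime_half_list f : polytime f -> polytime (fun x => half_list (f x)).
Proof.
move=> pf; apply: polytime_tl; apply: (@polytime_fold (fun _ _ a => half_step a)
  (fun _ => Leaf) f (fun _ => Node Leaf Leaf) (fun _ => 6)); rewrite /half_step.
- by auto 10 with polytime.
- exact: polysized_const.
- by move=> _ _ a; case: ifP => _; case: a => [|a b] /=; lia.
- exact: polytime_leaf.
- by [].
- by auto with polytime.
Qed.

(** For a bit [b], [n <= b + 2 m] iff [uphalf (n - b) <= m]: the length of the
    list [t] is reduced accordingly, so that nothing remains in the end iff it
    was at most the number with the binary expansion [k]. *)
Definition surplus (t k : tree) : tree :=
  foldl (fun t b => half_list (if b == Leaf then t else tree_tl t)) t (spine k).

Lemma surplus_leaf t bs :
  (surplus t (enc_seq enc_bool bs) == Leaf) = (size (spine t) <= bits_value bs).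
Proof.
rewrite /surplus spine_enc_seq; elim: bs t => [|b bs IH] t /=; first by case: t.
rewrite IH size_half_list; case: b => /=; last by rewrite add0n; lia.
by case: t => [|a t] /=; lia.
Qed.

Lemma polytime_surplus f g :
  polytime f -> polytime g -> polytime (fun x => surplus (f x) (g x)).
Proof.
move=> pf pg; apply: (@polytime_fold (fun _ b t =>
  half_list (if b == Leaf then t else tree_tl t)) (fun _ => Leaf) g f (fun _ => 1)) => //.
- by apply: polytime_half_list; auto 10 with polytime.
- exact: polysized_const.
- move=> _ b t; apply: leq_trans (tree_size_half_list _) _.
  by case: ifP => _; case: t => [|? ?] /=; lia.
- exact: polytime_leaf.
Qed.

Definition hamming_le (u0 u k : tree) : bool :=
  surplus (add_diff (names_tree u0) (names_tree u)
    (add_diff (names_tree u) (names_tree u0) Leaf)) k == Leaf.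

Lemma polytest_hamming_le f g h : polytime f -> polytime g -> polytime h ->
  polytest (fun x => hamming_le (f x) (g x) (h x)).
Proof.
move=> pf pg ph; apply: polytest_leaf; apply: polytime_surplus => //.
by repeat apply: polytime_add_diff; auto with polytime.
Qed.

Lemma hamming_leE u0 u k s0 s n : encodes u0 s0 -> encodes u s -> encodes_nat k n ->
  hamming_le u0 u k = (hamming (solution_names s0) (solution_names s) <= n).
Proof.
move=> e0 e1 [bs [<- ->]]; rewrite /hamming_le surplus_leaf; congr (_ <= _).
rewrite /hamming; set Z := (_ `|` _)%fset.
rewrite -(size_map enc_name (enum_fset Z)); apply: perm_size; apply: uniq_perm.
- by do 2 apply: uniq_add_diff.
- by rewrite (map_inj_uniq enc_name_inj) fset_uniq.
have mem_names w r v : encodes w r ->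
    (enc_name v \in spine (names_tree w)) = (v \in solution_names r).
  move=> ew; apply/idP/idP => [/(mem_names_tree _ ew)[v' v'_r /enc_name_inj->] //|v_r].
  by apply/(mem_names_tree _ ew); exists v.
move=> t; rewrite !mem_add_diff orFb; apply/idP/mapP => [|[v v_Z ->]].
  case/orP=> /andP[].
    move=> /(mem_names_tree _ e1)[v v_s ->]; rewrite (mem_names _ _ _ e0) => v_s0.
    by exists v => //; rewrite !inE v_s v_s0 orbT.
  move=> /(mem_names_tree _ e0)[v v_s ->]; rewrite (mem_names _ _ _ e1) => v_s0.
  by exists v => //; rewrite !inE v_s v_s0.
move: v_Z; rewrite (mem_names _ _ _ e0) (mem_names _ _ _ e1) !inE.
by case: (v \in solution_names s0); case: (v \in solution_names s).
Qed.

(** * The verifier *)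

(** The state is [Node Leaf L], where [L] lists the certificates of the
    remaining scenarios, or [Leaf] once a certificate has been refused. *)
Definition check_step (ok : tree -> tree -> tree -> bool) (a r : tree) : tree :=
  let cert := tree_hd (tree_tl a) in
  if (a != Leaf) && ok r (tree_hd cert) (tree_tl cert)
  then Node Leaf (tree_tl (tree_tl a)) else Leaf.

Definition check_all (ok : tree -> tree -> tree -> bool) (L : tree) (rs : seq tree) : tree :=
  foldl (check_step ok) (Node Leaf L) rs.

Lemma check_all_sound (ok : tree -> tree -> tree -> bool) L rs : check_all ok L rs <> Leaf ->
  forall r, r \in rs -> exists u w, ok r u w.
Proof.
rewrite /check_all; elim: rs L => [|r rs IH] L //=; rewrite {2}/check_step /=.
case: ifP => [ok_r acc r'|_ acc]; last first.
  by case: acc; elim: (rs) => //= r' rs' ->; rewrite /check_step.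
rewrite inE => /orP[/eqP->|/(IH _ acc) //].
by exists (tree_hd (tree_hd L)), (tree_tl (tree_hd L)).
Qed.

Lemma check_all_complete (ok : tree -> tree -> tree -> bool) (rs : seq tree) M :
  (forall r, r \in rs -> exists u w, ok r u w /\ tree_size u + tree_size w <= M) ->
  exists L, check_all ok L rs <> Leaf /\ tree_size L <= size rs * (M + 2) + 1.
Proof.
rewrite /check_all; elim: rs => [|r rs IH] cert; first by exists Leaf.
have [|L [acc le_L]] := IH; first by move=> r' r'_rs; apply: cert; rewrite inE r'_rs orbT.
have [u [w [ok_r le_M]]] := cert r (mem_head _ _).
exists (Node (Node u w) L); split; first by rewrite /= {2}/check_step /= ok_r.
by rewrite /= mulSn; lia.
Qed.

Lemma polytime_check_all (ok : tree -> tree -> tree -> tree -> bool) c L rs :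
  (forall f g h k, polytime f -> polytime g -> polytime h -> polytime k ->
    polytest (fun x => ok (f x) (g x) (h x) (k x))) ->
  polytime c -> polytime L -> polytime rs ->
  polytime (fun x => check_all (ok (c x)) (L x) (spine (rs x))).
Proof.
move=> pok pc pL prs; apply: (@polytime_fold (fun c r a => check_step (ok c) a r) c rs
  (fun x => Node Leaf (L x)) (fun _ => 0)) => //.
- by rewrite /check_step; auto 10 with polytime.
- exact: polysized_const.
- move=> c' r a; rewrite /check_step addn0.
  case: a => [|a [|? ?]] //=; have := tree_size_gt0 a; case: ifP => _ /=; lia.
- by auto with polytime.
Qed.

Theorem theorem8 (P : comb_problem)
    (scen : relsys -> tree -> relsys -> Prop)
    (hP : comb_inNP P)
    (hS : polynomially_computable P scen) :
  inNP (hdrr_language P scen).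
Proof.
case: hP => [[c1 [k1 bound1]] [fv [c2 [k2 [pfv fvs fvc]]]]].
case: hS => F [pF encF].
pose sol r u w := fv (Node (Node r u) w) != Leaf.
have psol f g h : polytime f -> polytime g -> polytime h ->
    polytest (fun x => sol (f x) (g x) (h x)).
  by move=> pf pg ph; do 2 apply: polytest_neg || apply: polytest_leaf;
    apply: (polytime_comp pfv); auto with polytime.
pose ok c r u w := sol r u w && hamming_le (tree_hd c) u (tree_tl c).
have pok f g h k : polytime f -> polytime g -> polytime h -> polytime k ->
    polytest (fun x => ok (f x) (g x) (h x) (k x)).
  move=> pf pg ph pk; apply: polytest_and; first exact: psol.
  by apply: polytest_hamming_le; auto with polytime.
pose bit t := (t == Leaf) || (t == Node Leaf Leaf).
pose V z :=
  let x := tree_hd z in let w := tree_tl z in let k := tree_tl (tree_tl x) in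
  [&& tree_tl x != Leaf, all bit (spine k),
      sol (tree_hd x) (tree_hd w) (tree_hd (tree_tl w)) &
      check_all (ok (Node (tree_hd w) k)) (tree_tl (tree_tl w)) (spine (F x)) != Leaf].
have pV : polytest V.
  apply: polytest_and; first by auto 10 with polytime.
  apply: polytest_and.
    by apply: polytest_all; rewrite /bit; auto 10 with polytime.
  apply: polytest_and; first by apply: psol; auto 10 with polytime.
  apply: polytest_neg; apply: polytest_leaf; apply: polytime_check_all => //;
    auto 10 with polytime.
  by apply: (polytime_comp pF); auto with polytime.
have solP r u w : sol r u w -> exists R s,
    [/\ encodes r R, encodes u s, instance P R & feasible P R s].
  by move/eqP/fvs=> [r' [u' [R [s [[-> ->] ? ? ? ?]]]]]; exists R, s.
pose X (x : tree) := poly_bound c1 k1 (tree_size x).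
pose W (x : tree) := poly_bound c2 k2 (tree_size x + X x + 1).
have certify r R s : encodes r R -> instance P R -> feasible P R s ->
    exists u w, [/\ encodes u s, sol r u w, tree_size u <= X r & tree_size w <= W r].
  move=> er iR fR; have [u [eu le_u]] := bound1 _ _ _ er iR fR.
  have [|w [acc le_w]] := fvc (Node r u); first by exists r, u, R, s.
  exists u, w; split=> //; first exact/eqP.
  apply: leq_trans le_w (poly_bound_mono _ _ _ _); first by lia.
  by rewrite /= /X; lia.
have XW_size : polysized (fun x => X x + W x).
  have hX : polysized X by apply: polysized_poly_bound; exact: polysized_size.
  apply: polysized_add => //; apply: polysized_poly_bound.
  by repeat apply: polysized_add => //; exact: polysized_size || exact: polysized_const.
have [c [k bXW]] := XW_size.
have [c3 [k3 bT]] : polysized (fun x => poly_bound c k (tree_size x) +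
    (tree_size (F x) * (poly_bound c k (tree_size (F x)) + 2) + 3)).
  have sF := polytime_size pF.
  apply: polysized_add; first by apply: polysized_poly_bound; exact: polysized_size.
  apply: polysized_add (polysized_const _); apply: polysized_mul => //.
  by apply: polysized_add (polysized_const _); apply: polysized_poly_bound.
exists (fun z => enc_bool (V z)), c3, k3; split=> //.
- move=> x w; case Vxw: (V _) => // _; move: Vxw; rewrite /V /=.
  case: x => [|x0 [|d kt]] //= /and3P[bits /solP[s00 [s0 [e0 eu0 i0 f0]]] /eqP acc].
  have [bs k_bs] : exists bs, kt = enc_seq enc_bool bs.
    have [bs h] : exists bs, spine kt = map enc_bool bs.
      elim: (spine kt) bits => [|t l IH] /=; first by exists [::].
      case/andP=> /orP[]/eqP-> /IH[bs ->]; first by exists (false :: bs).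
      by exists (true :: bs).
    by exists bs; exact: enc_seq_spine.
  have ek : encodes_nat kt (bits_value bs) by exists bs.
  have ex : encodes_input (Node x0 (Node d kt)) s00 d (bits_value bs) by exists x0, kt.
  have [ls [uniq_ls scen_ls Fx]] := encF _ _ _ _ ex i0.
  have ok_scen sg : scen s00 d sg -> instance P sg /\ exists s, feasible P sg s /\
      hamming (solution_names s0) (solution_names s) <= bits_value bs.
    move=> /scen_ls/mapP[l l_ls ->].
    have [|u [v /andP[/solP[R [s [er eu iR fR]]] ham]]] :=
      check_all_sound acc (r := enc_listing l).
      by rewrite Fx spine_enc_seq; exact: map_f.
    have eR : R = relsys_of l.
      by case: er => l' [_ <- /enc_listing_inj->].
    rewrite -eR; split=> //; exists s; split=> //.
    by rewrite -(hamming_leE eu0 eu ek).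
  exists s00, d, (bits_value bs); split=> //; first by move=> sg /ok_scen[].
  by exists s0; split=> // sg /ok_scen[].
- move=> x [s00 [d [kp [ex i0 inst [s0 [f0 rec]]]]]].
  have [ls [uniq_ls scen_ls Fx]] := encF _ _ _ _ ex i0.
  case: ex => x0 [kt [def_x e0 ek]].
  have [u0 [w0 [eu0 acc0 le_u0 le_w0]]] := certify _ _ _ e0 i0 f0.
  have [|L [acc le_L]] := @check_all_complete (ok (Node u0 kt)) (spine (F x))
      (poly_bound c k (tree_size (F x))).
    rewrite {1}Fx spine_enc_seq => r /mapP[l l_ls ->].
    have scen_l : scen s00 d (relsys_of l) by apply/scen_ls; exact: map_f.
    have [s [fs ham]] := rec _ scen_l.
    have el : encodes (enc_listing l) (relsys_of l).
      by exists l; split=> //; exact: (allP uniq_ls).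
    have [u [w [eu acc_l le_u le_w]]] := certify _ _ _ el (inst _ scen_l) fs.
    exists u, w; split; first by rewrite /ok acc_l (hamming_leE eu0 eu ek).
    apply: leq_trans (leq_trans (leq_add le_u le_w) (bXW _)) _.
    apply: poly_bound_mono; first exact: tree_size_gt0.
    by apply: tree_size_mem_spine; rewrite Fx spine_enc_seq; exact: map_f.
  exists (Node u0 (Node w0 L)); split.
    have bits : all bit (spine kt).
      by case: ek => bs [_ ->]; rewrite spine_enc_seq; elim: bs => //= -[].
    by rewrite /V def_x /= bits acc0 -def_x /=; case: eqP acc.
  apply: leq_trans (bT x); have /= := leq_add le_u0 le_w0.
  have := bXW x0; have := size_spine (F x).
  have : poly_bound c k (tree_size x0) <= poly_bound c k (tree_size x).
    by rewrite def_x; apply: poly_bound_mono => //=; lia.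
  nia.
Qed.
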